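(* Let $p\in[0,1]$ be a constant (independent of $n$) with $p\ge 0.67$. Then the probability that there exist an integer $s$ with $2\le s<3^n$ and a set $S\in C_s$ such that no edge of $P^n_{3,p}$ joins $S$ to $V(P_3^n)\setminus S$ tends to $0$ as $n\to\infty$. Hence the probability that $P^n_{3,p}$ is connected tends to $1$ as $n\to\infty$.
   Context: $P_3$ is the path with 3 vertices (length 2). For a positive integer $n$, $P_3^n$ is the Cartesian product of $n$ copies of $P_3$: its vertex set $V(P_3^n)$ consists of the vectors $x=(x_1,\dots,x_n)\in\{0,1,2\}^n$, and $x,y$ are adjacent if and only if there is an index $i$ with $|x_i-y_i|=1$ and $x_j=y_j$ for all $j\ne i$. The random subgraph $P^n_{3,p}$ contains all vertices of $P_3^n$ and each edge of $P_3^n$ independently with probability $p$. $C_s$ denotes the family of all $s$-element subsets $S\subseteq V(P_3^n)$ such that the subgraph of $P_3^n$ induced on $S$ is connected. *)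

(* Defs.v *)
From HB Require Import structures.
From mathcomp Require Import all_boot all_order all_algebra.
From mathcomp Require Import reals.

Set Implicit Arguments.
Unset Strict Implicit.
Unset Printing Implicit Defensive.

Import Order.TTheory GRing.Theory Num.Theory.

Local Open Scope ring_scope.

Section Connectivity.
Variables (T : finType) (e : rel T).

Definition induced (S : {set T}) : rel T :=
  [rel x y | [&& x \in S, y \in S & e x y]].

(* The null graph counts as disconnected. *)
Definition induced_connected (S : {set T}) : bool :=
  (S != set0) && [forall x in S, forall y in S, connect (induced S) x y].

End Connectivity.

Section P3Power.
Variable n : nat.

Definition vertex : finType := {ffun 'I_n -> 'I_3}.

Definition adj : rel vertex := fun x y =>
  [exists i : 'I_n, (`|(x i)%:Z - (y i)%:Z| == 1 :> int) &&
    [forall j : 'I_n, (j != i) ==> (x j == y j)]].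

Definition edges : {set {set vertex}} :=
  [set e | [exists x, exists y, adj x y && (e == [set x; y])]].

Definition connected_sets (s : nat) : {set {set vertex}} :=
  [set S : {set vertex} | (#|S| == s) && induced_connected adj S].

(* A spanning subgraph is identified with its edge set F. *)
Definition sub_adj (F : {set {set vertex}}) : rel vertex :=
  fun x y => [set x; y] \in F.

Definition sub_connected (F : {set {set vertex}}) : bool :=
  induced_connected (sub_adj F) setT.

Definition no_crossing_edge (F : {set {set vertex}}) (S : {set vertex}) : bool :=
  [forall x in S, forall y in ~: S, ~~ sub_adj F x y].

Definition has_isolated_connected_set (F : {set {set vertex}}) : bool :=
  [exists s : 'I_(3 ^ n), (2 <= s)%N &&
    [exists S in connected_sets s, no_crossing_edge F S]].

(* The law of the random spanning subgraph whose edges are kept independently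
   with probability p, given by its mass function on subsets of edges. *)
Definition percolation_mass (R : realType) (p : R) (F : {set {set vertex}}) : R :=
  \prod_(e in edges) (if e \in F then p else 1 - p).

Definition percolation_prob (R : realType) (p : R)
    (A : pred {set {set vertex}}) : R :=
  \sum_(F : {set {set vertex}} | (F \subset edges) && A F) percolation_mass p F.

(* The edge indicators are independent with mean p; D = set0 gives total mass 1. *)
Lemma percolation_prob_subset (R : realType) (p : R) (D : {set {set vertex}}) :
  D \subset edges ->
  percolation_prob p (fun F : {set {set vertex}} => D \subset F) = p ^+ #|D|.
Proof.
move=> sDE; rewrite /percolation_prob /percolation_mass.
pose f e : R := if e \in edges then p else 0.
pose g e : R := if e \in D then 0 else if e \in edges then 1 - p else 1.
have := bigA_distr 1 +%R f g => /=.
rewrite (bigID (fun e => e \in D)) /= [X in _ * X]big1 => [|e eD]; last first.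
  by rewrite /f /g (negbTE eD); case: ifP => _; rewrite ?add0r// addrC subrK.
rewrite (eq_bigr (fun=> p)) => [|e eD]; last first.
  by rewrite /f /g eD (subsetP sDE) ?addr0.
rewrite prodr_const mulr1 => ->.
rewrite [RHS](bigID (fun F : {set {set vertex}} => (F \subset edges) && (D \subset F))) /=.
rewrite [X in _ = _ + X]big1 ?addr0 => [|F /=]; last first.
  rewrite negb_and => /orP[] /subsetPn[e e1 e2].
    by rewrite (bigD1 e)//= e1 /f (negbTE e2) mul0r.
  by rewrite (bigD1 e)//= (negbTE e2) /g e1 mul0r.
apply: eq_bigr => F /andP[sFE sDF].
rewrite [RHS](bigID (mem edges)) /= [X in _ = _ * X]big1 ?mulr1 => [|e eE].
  apply: eq_bigr => e eE; rewrite /f /g eE; case: ifPn => // eF.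
  by case: ifPn => // /(subsetP sDF); rewrite (negbTE eF).
rewrite /g (negbTE eE) ifF; last by apply/negbTE/(contra _ eE)/(subsetP sFE).
by rewrite ifF //; apply/negbTE/(contra _ eE)/(subsetP sDE).
Qed.

End P3Power.

(* Main.v *)
From HB Require Import structures.
From mathcomp Require Import all_boot all_order all_algebra.
From mathcomp Require Import reals zify ring lra.
Require Import Defs.

Set Implicit Arguments.
Unset Strict Implicit.
Unset Printing Implicit Defensive.

Import Order.TTheory GRing.Theory Num.Theory.
Local Open Scope ring_scope.

(** Sprinkling. Put q = 1 - p <= 33/100 and write the p-percolation as a
    p1-percolation G, p1 = 13/20, to which further edges are added, so that a
    given set of k edges missing from G is still missing at the end with
    probability (q / (1 - p1)) ^ k.
    A vertex with k coordinates equal to 1 has n + k incident edges, so the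
    expected number of isolated vertices of G is (2 q1 + q1 ^ 2) ^ n with
    q1 = 1 - p1, which is exponentially small; the same computation with a bit
    of room shows that with high probability every vertex of G has edges in at
    least d = n / 40 directions. Then two steps from any vertex already reach
    about d ^ 2 / 2 vertices, so all components of G have quadratic size.
    A union S of components of G with at most half of the vertices has at least
    #|S| / 6 boundary edges, so each of its components costs a factor
    (q / q1) ^ (c n ^ 2) against the at most 3 ^ n choices of that component:
    the added edges join all the components. *)

(** * Bernoulli random subsets and their monotone coupling *)

Section RandomSubset.
Variables (T : finType) (E : {set T}).

Lemma sum_subset_prod (R : comNzRingType) (a b : T -> R) :
  \sum_(F : {set T} | F \subset E)
     \prod_(e in E) (if e \in F then a e else b e) =
  \prod_(e in E) (a e + b e).
Proof.
(* Off E the pair (0, 1) contributes a factor 1 to the product and kills every F that is not inside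
   E. *)
pose f e := if e \in E then a e else 0.
pose g e := if e \in E then b e else 1.
transitivity (\prod_e (f e + g e)).
  rewrite bigA_distr [RHS](bigID (fun F : {set T} => F \subset E)) /=.
  rewrite [X in _ = _ + X]big1 ?addr0 => [|F /subsetPn[e eF eE]]; last first.
    by rewrite (bigD1 e) //= eF /f (negbTE eE) mul0r.
  apply: eq_bigr => F sFE.
  rewrite [RHS](bigID (mem E)) /= [X in _ = _ * X]big1 ?mulr1 => [|e eE].
    by apply: eq_bigr => e eE; rewrite /f /g eE.
  rewrite /g (negbTE eE) ifF //.
  by apply/negbTE; apply: contra eE; apply: subsetP.
rewrite (bigID (mem E)) /= [X in _ * X]big1 ?mulr1 => [|e eE].
  by apply: eq_bigr => e eE; rewrite /f /g eE.
by rewrite /f /g (negbTE eE) add0r.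
Qed.

(** Replacing [a] by 0 on D annihilates exactly the contributions of the sets F that meet D, which
    reduces the claim to the unrestricted sum. *)
Lemma sum_subset_avoid_prod (R : comNzRingType) (D : {set T}) (a b : T -> R) :
  D \subset E ->
  \sum_(F : {set T} | (F \subset E) && [disjoint F & D])
     \prod_(e in E) (if e \in F then a e else b e) =
  \prod_(e in E) (if e \in D then b e else a e + b e).
Proof.
move=> sDE.
transitivity (\sum_(F : {set T} | F \subset E)
  \prod_(e in E) (if e \in F then (if e \in D then 0 else a e) else b e)).
  rewrite [RHS](bigID (fun F : {set T} => [disjoint F & D])) /=.
  rewrite [X in _ = _ + X]big1 ?addr0 =>
    [|F /andP[_ /pred0Pn[e /andP[/= eF eD]]]].
    apply: eq_bigr => F /andP[_ FD]; apply: eq_bigr => e _.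
    by case: ifP => // eF; rewrite (disjointFr FD eF).
  by rewrite (bigD1 e) ?(subsetP sDE) //= eF eD mul0r.
rewrite sum_subset_prod; apply: eq_bigr => e _.
by case: ifP => _; rewrite ?add0r.
Qed.

Variable R : numFieldType.
Implicit Types (p : R) (F G D : {set T}).

Definition bernoulli_mass p F : R :=
  \prod_(e in E) (if e \in F then p else 1 - p).

Lemma bernoulli_mass_ge0 p F : 0 <= p <= 1 -> 0 <= bernoulli_mass p F.
Proof.
move=> /andP[p0 p1]; apply: prodr_ge0 => e _.
by case: ifP => _; rewrite ?subr_ge0.
Qed.

Lemma bernoulli_avoid p D : D \subset E ->
  \sum_(F : {set T} | (F \subset E) && [disjoint F & D]) bernoulli_mass p F =
  (1 - p) ^+ #|D|.
Proof.
move=> sDE; rewrite (sum_subset_avoid_prod _ _ sDE).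
rewrite (bigID (mem D)) /= [X in _ * X]big1 ?mulr1 => [|e /andP[_ /negbTE->]].
  rewrite (eq_bigl (mem D)) => [|e /=]; last first.
    by rewrite andb_idl // => eD; apply: (subsetP sDE).
  by rewrite -prodr_const; apply: eq_bigr => e eD; rewrite ifT.
by rewrite addrC subrK.
Qed.

Lemma bernoulli_total p :
  \sum_(F : {set T} | F \subset E) bernoulli_mass p F = 1.
Proof.
rewrite -[RHS](expr0 (1 - p)) -(@cards0 T) -(bernoulli_avoid p (sub0set E)).
by apply: eq_bigl => F; rewrite -setI_eq0 setI0 eqxx andbT.
Qed.

(* Joint law of a pair G \subset F whose marginals are Bernoulli with
   parameters p1 (for G) and p (for F). *)
Definition coupling_mass p1 p G F : R :=
  \prod_(e in E) (if e \in F then (if e \in G then p1 else p - p1)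
                  else (if e \in G then 0 else 1 - p)).

Lemma coupling_mass_ge0 p1 p G F : 0 <= p1 -> p1 <= p -> p <= 1 ->
  0 <= coupling_mass p1 p G F.
Proof.
move=> p10 p1p p_le1; apply: prodr_ge0 => e _.
by case: ifP => _; case: ifP => _; rewrite ?subr_ge0.
Qed.

Lemma coupling_marginal p1 p F :
  \sum_(G : {set T} | G \subset E) coupling_mass p1 p G F = bernoulli_mass p F.
Proof.
transitivity (\sum_(G : {set T} | G \subset E) \prod_(e in E) (if e \in G then
    (if e \in F then p1 else 0) else (if e \in F then p - p1 else 1 - p))).
  by apply: eq_bigr => G _; apply: eq_bigr => e _; do 2!case: ifP.
rewrite sum_subset_prod; apply: eq_bigr => e _.
by case: ifP => _; rewrite ?add0r // addrC subrK.
Qed.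

(** This is the price of sprinkling: once G misses D, each edge of D stays missing independently
    with conditional probability (1 - p) / (1 - p1). If G meets D, then F meets D too, since G lies
    inside F almost surely. *)
Lemma coupling_avoid p1 p G D : p1 != 1 -> D \subset E ->
  \sum_(F : {set T} | (F \subset E) && [disjoint F & D]) coupling_mass p1 p G F
    =
  if [disjoint G & D] then bernoulli_mass p1 G * ((1 - p) / (1 - p1)) ^+ #|D|
  else 0.
Proof.
move=> p1_neq1 sDE; rewrite (sum_subset_avoid_prod _ _ sDE).
case: ifPn => [GD|/pred0Pn[e /andP[/= eG eD]]]; last first.
  by rewrite (bigD1 e) ?(subsetP sDE) //= eD eG mul0r.
rewrite (bigID (mem D)) /= /bernoulli_mass [in RHS](bigID (mem D)) /= mulrAC.
congr (_ * _); last first.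
  apply: eq_bigr => e /andP[_ /negbTE->]; case: ifP => _; rewrite ?addr0 //.
  by rewrite addrC addrA subrK.
have -> : #|D| = #|[predI E & D]|.
  by apply: eq_card => e; rewrite inE andb_idl // => /(subsetP sDE).
rewrite -prodr_const -big_split /=; apply: eq_bigr => e /andP[_ eD].
by rewrite eD (disjointFl GD eD) mulrC divfK // subr_eq0 eq_sym.
Qed.

Lemma coupling_total p1 p G : p1 != 1 ->
  \sum_(F : {set T} | F \subset E) coupling_mass p1 p G F = bernoulli_mass p1 G.
Proof.
move=> p1_neq1; have := coupling_avoid p G p1_neq1 (sub0set E).
rewrite cards0 mulr1 -setI_eq0 setI0 eqxx => <-.
by apply: eq_bigl => F; rewrite -setI_eq0 setI0 eqxx andbT.
Qed.

End RandomSubset.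

Lemma sum_expr_card (R : comNzRingType) (T : finType) (y : R) :
  \sum_(J : {set T}) y ^+ #|J| = (1 + y) ^+ #|T|.
Proof.
transitivity (\prod_(i : T) (y + 1)); last by rewrite prodr_const addrC.
by rewrite bigA_distr; apply: eq_bigr => J _;
  rewrite -big_mkcond /= prodr_const.
Qed.

Lemma card_dep_pair (T1 T2 : finType) (A : {set T1}) (B : T1 -> {set T2}) :
  #|[set u : T1 * T2 | (u.1 \in A) && (u.2 \in B u.1)]| =
  (\sum_(i in A) #|B i|)%N.
Proof.
rewrite -sum1_card (eq_bigl _ _ (fun u => in_set _ u)).
rewrite -(pair_big_dep (fun i => i \in A) (fun i j => j \in B i) (fun _ _ =>
  1%N)).
by apply: eq_bigr => i _; rewrite sum1_card.
Qed.

(** * Moves, edges and edge boundaries in the grid *)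

Section Grid.
Variable n : nat.
Implicit Types (x y u w : vertex n) (i j k : 'I_n) (a b c : 'I_3).
Implicit Types (S : {set vertex n}) (F : {set {set vertex n}}).

Definition step : rel 'I_3 := fun a b => `|a%:Z - b%:Z| == 1 :> int.

Definition upd x i a : vertex n := [ffun j => if j == i then a else x j].

Lemma updE x i a j : upd x i a j = if j == i then a else x j.
Proof. by rewrite ffunE. Qed.

Lemma upd_upd x i a b : upd (upd x i a) i b = upd x i b.
Proof. by apply/ffunP => j; rewrite !updE; case: eqP. Qed.

Lemma upd_id x i : upd x i (x i) = x.
Proof. by apply/ffunP => j; rewrite !updE; case: eqP => [->|]. Qed.

Lemma step_sym a b : step a b = step b a.
Proof. by rewrite /step distrC. Qed.

Lemma step_neq a b : step a b -> b != a.
Proof. by apply: contraTneq => ->; rewrite /step subrr. Qed.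

Lemma adjP x y : reflect (exists i a, step (x i) a /\ y = upd x i a) (adj x y).
Proof.
apply: (iffP existsP) => [[i /andP[xy /forallP eq_xy]]|[i [a [xa ->]]]].
  exists i, (y i); split=> //; apply/ffunP => j; rewrite updE.
  by case: eqVneq => [->//|ji]; have /implyP/(_ ji)/eqP := eq_xy j.
exists i; rewrite updE eqxx -[_ == 1]/(step (x i) a) xa /=.
by apply/forallP => j; apply/implyP => /negbTE; rewrite updE => ->.
Qed.

Lemma adj_sym : symmetric (@adj n).
Proof.
move=> x y; wlog suff: x y / adj x y -> adj y x
  by move=> H; apply/idP/idP; apply: H.
case/adjP=> i [a [xa ->]]; apply/adjP; exists i, (x i).
by rewrite updE eqxx step_sym upd_upd upd_id.
Qed.

Lemma edges_adj x y : ([set x; y] \in edges n) = adj x y.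
Proof.
apply/idP/idP => [|xy]; last by rewrite inE; apply/existsP; exists x;
  apply/existsP; exists y; rewrite xy eqxx.
rewrite inE => /existsP[x' /existsP[y' /andP[xy' /eqP/setP E]]].
have := (E x, E y, E x', E y'); rewrite !inE !eqxx ?orbT /=.
move=> [[[/esym/orP Ex /esym/orP Ey] /orP Ex'] /orP Ey'].
case: Ex Ey Ex' Ey' => [/eqP->|/eqP->] [/eqP->|/eqP->];
  rewrite ?xy' 1?adj_sym //.
  move=> _ [/eqP Exy|/eqP Exy]; by rewrite -{1}Exy // adj_sym.
move=> [/eqP Exy|/eqP Exy] _; by rewrite -{1}Exy // adj_sym.
Qed.

Lemma sub_adj_sym F : symmetric (sub_adj F).
Proof. by move=> x y; rewrite /sub_adj setUC. Qed.

Lemma upd_inj x i j a b : a != x i -> b != x j -> upd x i a = upd x j b ->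
  (i, a) = (j, b).
Proof.
move=> ai bj /ffunP E; have := E i; have := E j; rewrite !updE !eqxx.
case: eqP => [->|_]; first by rewrite eqxx => ->.
by move=> /eqP; rewrite eq_sym (negbTE bj).
Qed.

(** Boundary edges are oriented outwards and coded by inner endpoint, direction and new value. The
    inner endpoint is recognised by membership in S, so each boundary edge has a single code. *)
Definition crossing S : {set vertex n * ('I_n * 'I_3)} :=
  [set t | [&& t.1 \in S, upd t.1 t.2.1 t.2.2 \notin S
             & step (t.1 t.2.1) t.2.2]].

Definition cut S : {set {set vertex n}} :=
  [set [set t.1; upd t.1 t.2.1 t.2.2] | t in crossing S].

Lemma card_cut S : #|cut S| = #|crossing S|.
Proof.
apply: card_in_imset => -[x [i a]] [y [j b]]; rewrite !inE /=.
move=> /and3P[xS xaS xa] /and3P[yS ybS yb] /setP E.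
have Exy : x = y.
  have := E x; rewrite !inE eqxx /= => /esym/orP[/eqP//|/eqP Ex].
  by rewrite -Ex xS in ybS.
congr (_, _) => //; subst y; apply: (@upd_inj x); rewrite ?step_neq //.
have := E (upd x i a); rewrite !inE eqxx orbT => /esym/orP[/eqP Ex|/eqP//].
by rewrite Ex xS in xaS.
Qed.

Lemma cut_sub_edges S : cut S \subset edges n.
Proof.
apply/subsetP => e /imsetP[[x [i a]]]; rewrite inE /= => /and3P[_ _ xa] ->.
by rewrite edges_adj; apply/adjP; exists i, a.
Qed.

Lemma no_crossing_cut F S : F \subset edges n ->
  no_crossing_edge F S = [disjoint F & cut S].
Proof.
move=> sFE; apply/forallP/pred0P => [H e|H x].
  apply/negbTE/negP => /andP[/= eF /imsetP[[x [i a]]]]; rewrite inE /=.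
  move=> /and3P[xS xaS xa] Ee; have /implyP/(_ xS)/forallP := H x.
  by move=> /(_ (upd x i a)); rewrite inE xaS /sub_adj -Ee eF.
apply/implyP => xS; apply/forallP => y; apply/implyP; rewrite inE => yS.
apply/negP => xyF; have := subsetP sFE _ xyF; rewrite edges_adj => /adjP.
move=> [i [a [xa Ey]]]; have := H [set x; y]; rewrite /= [_ \in F]xyF /=.
move/negbT/negP; apply; apply/imsetP; exists (x, (i, a)); last by rewrite /= Ey.
by rewrite inE /= xS -Ey yS.
Qed.

(** * Edge isoperimetry *)

Lemma card_vertex : #|{: vertex n}| = (3 ^ n)%N.
Proof. by rewrite card_ffun !card_ord. Qed.

Definition hybrid (m : nat) x y : vertex n :=
  [ffun i : 'I_n => if (i < m)%N then y i else x i].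

Lemma step_cross (P : pred 'I_3) a b : P a -> ~~ P b ->
  exists c c', [/\ step c c', P c & ~~ P c'].
Proof.
move=> Pa Pb; case: (boolP (step a b)) => [ab|nab]; first by exists a, b.
(* Distinct values that are not adjacent are 0 and 2, so the walk passes through 1. *)
pose m : 'I_3 := inord 1.
have neq_ab : a != b by apply: contraNneq Pb => <-.
have [am mb] : step a m /\ step m b.
  rewrite /step !inordK //; move: neq_ab nab.
  by case: a b {Pa Pb} => [[|[|[|]]] //= ?] [[|[|[|]]] //= ?].
by case: (boolP (P m)) => Pm; [exists m, b | exists a, m].
Qed.

(* Walk from x in S to y outside S by replacing coordinates one at a time; the
   first exit happens in some direction k, and (x, y) can be recovered from a
   boundary edge on the line of the exit, the position of the exit on that line
   and the complementary hybrid. *)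
Lemma isoperimetry S : (#|S| * #|~: S| <= #|crossing S| * (3 * 3 ^ n))%N.
Proof.
pose dec (v : vertex n * ('I_n * 'I_3) * ('I_3 * vertex n)) :=
  let k := v.1.2.1 in let u := upd v.1.1 k v.2.1 in
  (hybrid k u v.2.2, hybrid k v.2.2 u).
have -> : (#|crossing S| * (3 * 3 ^ n) =
    #|setX (crossing S) (setX [set: 'I_3] [set: vertex n])|)%N.
  by rewrite !cardsX !cardsT card_ord card_vertex.
rewrite -cardsX.
apply: leq_trans (leq_imset_card dec _); apply: subset_leq_card.
apply/subsetP => -[x y]; rewrite !inE /= => /andP[xS yS].
have exm : exists m, hybrid m x y \notin S.
  exists n; suff -> : hybrid n x y = y by [].
  by apply/ffunP => i; rewrite ffunE ltn_ord.
case: (ex_minnP exm) => [[|m] mS minm].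
  by move: mS; rewrite (_ : hybrid 0 x y = x) ?xS //; apply/ffunP => i;
    rewrite ffunE.
have uS : hybrid m x y \in S.
  by apply/negPn/negP => /minm; rewrite ltnn.
have mn : (m < n)%N.
  rewrite ltnNge; apply/negP => nm; move: mS.
  rewrite (_ : hybrid m.+1 x y = hybrid m x y) ?uS //.
  apply/ffunP => i; rewrite !ffunE ltnS (leq_trans (ltn_ord i) nm).
  by rewrite (leq_trans (ltnW (ltn_ord i)) nm).
pose k := Ordinal mn; set u := hybrid m x y in uS.
have Eu : hybrid m.+1 x y = upd u k (y k).
  apply/ffunP => i; rewrite !ffunE ltnS leq_eqVlt -val_eqE /=.
  by case: eqVneq => // Ei; congr (y _); apply: val_inj.
(* The edge leaving S on the line through u in direction k need not start at u; hence the value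
   [u k] is stored for [dec] as well. *)
have := @step_cross (fun a => upd u k a \in S) (u k) (y k).
rewrite upd_id -Eu => /(_ uS mS)[b [c [bc bS cS]]].
apply/imsetP; exists ((upd u k b, (k, c)), (u k, hybrid k y x)).
  by rewrite !inE /= upd_upd bS cS updE eqxx bc.
rewrite /dec /= upd_upd upd_id; congr (_, _); apply/ffunP => i;
  by rewrite /u !ffunE; case: (i < m)%N.
Qed.

(** The complement holds at least half of the 3^n vertices, so [isoperimetry] leaves the constant 2
    · 3 = 6. *)
Lemma card_le_cut S : (2 * #|S| <= 3 ^ n)%N -> (#|S| <= 6 * #|cut S|)%N.
Proof.
move=> halfS; have := isoperimetry S; have := cardsC S.
rewrite card_cut card_vertex; have : (0 < 3 ^ n)%N by rewrite expn_gt0.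
move: #|S| #|~: S| #|crossing S| (3 ^ n)%N halfS => s s' c N; nia.
Qed.

(** * Open directions and the size of components *)

Definition open_dirs F x : {set 'I_n} :=
  [set i | [exists a, step (x i) a && ([set x; upd x i a] \in F)]].

Definition star x (I : {set 'I_n}) : {set {set vertex n}} :=
  [set [set x; upd x k.1 k.2] |
     k in [set k : 'I_n * 'I_3 | (k.1 \in I) &&
                                  (k.2 \in [set a | step (x k.1) a])]].

Lemma card_star x I : #|star x I| = (\sum_(i in I) #|[set a | step (x i) a]|)%N.
Proof.
rewrite -card_dep_pair; apply: card_in_imset => -[i a] [j b]; rewrite !inE /=.
move=> /andP[_ xa] /andP[_ xb] /setP E; apply: (@upd_inj x);
  rewrite ?step_neq //.
have := E (upd x i a); rewrite !inE eqxx orbT =>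
  /esym/orP[/eqP/ffunP/(_ i)|/eqP//].
by rewrite updE eqxx => Ea; have := step_neq xa; rewrite Ea eqxx.
Qed.

Lemma star_sub_edges x I : star x I \subset edges n.
Proof.
apply/subsetP => e /imsetP[[i a] ia ->]; rewrite edges_adj.
by move: ia; rewrite !inE => /andP[_ xa]; apply/adjP; exists i, a.
Qed.

Lemma disjoint_star F x : [disjoint F & star x (~: open_dirs F x)].
Proof.
apply/pred0P => e; apply/negbTE/negP => /andP[/= eF /imsetP[[i a]]].
rewrite !inE /= => /andP[/existsPn/(_ a) H xa] Ee.
by rewrite xa -Ee eF in H.
Qed.

Definition component F x : {set vertex n} := [set y | connect (sub_adj F) x y].

(* Two steps from x in distinct directions i and j end at a vertex that differs
   from x exactly in i and j, hence determines (i, j) up to order. *)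
Lemma card_component (d : nat) F x : (forall y, d <= #|open_dirs F y|)%N ->
  (d * d.-1 <= 2 * #|component F x|)%N.
Proof.
move=> Fd.
(* One open neighbour of y is chosen in each open direction; in a closed direction the default [y i]
   gives y itself. *)
pose nb y i := upd y i (odflt (y i)
  [pick a | step (y i) a && ([set y; upd y i a] \in F)]).
have nbP y i : i \in open_dirs F y -> sub_adj F y (nb y i) /\ nb y i i != y i.
  rewrite inE /nb => /existsP[a Ha].
  case: pickP => [b /andP[yb]|/(_ a)]; last by rewrite Ha.
  by move=> /= bF; rewrite updE eqxx step_neq.
have nbE y i j : j != i -> nb y i j = y j by rewrite /nb updE => /negbTE->.
pose P := [set p : 'I_n * 'I_n | (p.1 \in open_dirs F x) &&
                                (p.2 \in open_dirs F (nb x p.1) :\ p.1)].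
(* Forbidding the first direction in the second step removes at most one of at least d choices. *)
have cardP : (d * d.-1 <= #|P|)%N.
  rewrite (card_dep_pair _ (fun i => open_dirs F (nb x i) :\ i)).
  apply: leq_trans (_ : \sum_(i in open_dirs F x) d.-1 <= _)%N.
    by rewrite sum_nat_const leq_mul2r Fd orbT.
  apply: leq_sum => i _; have := Fd (nb x i).
  by rewrite (cardsD1 i); set c := #|_ :\ _|; set b := i \in _; rewrite -/c;
    case: b => /=; lia.
apply: leq_trans cardP _.
(* The endpoint loses only the order of the two directions. The Boolean restores it and accounts for
   the factor 2. *)
pose f (p : 'I_n * 'I_n) := (nb (nb x p.1) p.2, (p.1 < p.2)%N).
have zP p : p \in P -> forall k,
  (nb (nb x p.1) p.2 k != x k) = (k \in [set p.1; p.2]).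
  case: p => i j; rewrite in_set /= in_setD1 =>
    /and3P[/nbP[_ xi] ij /nbP[_ xj]] k; rewrite in_set2.
  case: (eqVneq k j) => [->|kj];
    first by rewrite orbT -[X in _ != X](nbE _ i) // eq_sym.
  by rewrite nbE // orbF; case: (eqVneq k i) => [->//|ki]; rewrite nbE ?eqxx.
have f_inj : {in P &, injective f}.
  move=> [i j] [i' j'] pP pP' [Ez Elt].
  have E : [set i; j] = [set i'; j'].
    by apply/setP => k; rewrite -(zP _ pP) -(zP _ pP') /= Ez.
  move: pP pP'; rewrite !inE /= => /and3P[_ ij _] /and3P[_ ij' _].
  move/setP: E => E; have := (E i, E j); rewrite !inE !eqxx ?orbT /=.
  move: ij ij' Elt; rewrite -!val_eqE /= => ij ij' Elt.
  move=> [/esym/orP[/eqP Ei|/eqP Ei] /esym/orP[/eqP Ej|/eqP Ej]];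
    congr (_, _); apply: val_inj => /=; lia.
rewrite -(card_in_imset f_inj) -card_bool mulnC -cardsT -cardsX.
apply: subset_leq_card; apply/subsetP => _ /imsetP[[i j] + ->].
rewrite in_set /= in_setD1 => /and3P[/nbP[xi _] _ yj];
  rewrite in_setX in_setT andbT inE.
by apply: connect_trans (connect1 xi) (connect1 (nbP _ _ yj).1).
Qed.

(** * Sets without crossing edges, and connectivity *)

Lemma no_crossing_closed F S : no_crossing_edge F S ->
  forall x y, connect (sub_adj F) x y -> (x \in S) = (y \in S).
Proof.
move=> noF; apply: closed_connect => x y xy.
have key u w : sub_adj F u w -> u \in S -> w \in S.
  move=> uw uS; have /forallP/(_ u)/implyP/(_ uS)/forallP/(_ w)/implyP := noF.
  by rewrite inE uw => H; apply/negPn/negP => /H.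
by apply/idP/idP; apply: key; rewrite // sub_adj_sym.
Qed.

Lemma sub_connectedP F :
  reflect (forall x y, connect (sub_adj F) x y) (sub_connected F).
Proof.
have E : induced (sub_adj F) setT =2 sub_adj F.
  by move=> x y; rewrite /induced /= !in_setT.
apply: (iffP andP) => [[_ H] x y|H].
  by move/forall_inP/(_ x)/(_ (in_setT _))/forall_inP/(_ y)/(_ (in_setT _)): H;
    rewrite (eq_connect E).
split; first by apply/set0Pn; exists [ffun=> ord0]; rewrite inE.
by apply/forall_inP => x _; apply/forall_inP => y _; rewrite (eq_connect E).
Qed.

Lemma isolated_disconnected F : has_isolated_connected_set F ->
  ~~ sub_connected F.
Proof.
case/existsP => s /andP[s2 /exists_inP[S]]; rewrite inE => /andP[/eqP cS _] noF.
have [x xS] : exists x, x \in S.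
  by apply/card_gt0P; rewrite cS; apply: leq_trans s2.
have [y yS] : exists y, y \in ~: S.
  by apply/card_gt0P; have := cardsC S; rewrite cS card_vertex;
    have := ltn_ord s; lia.
apply/negP => /sub_connectedP/(_ x y)/(no_crossing_closed noF).
by rewrite xS; move: yS; rewrite inE => /negbTE->.
Qed.

Lemma no_crossingC F S : no_crossing_edge F S -> no_crossing_edge F (~: S).
Proof.
move=> /no_crossing_closed clS; apply/forall_inP => x; rewrite inE => xS.
apply/forall_inP => y; rewrite setCK => yS; apply/negP => /connect1/clS.
by rewrite yS (negbTE xS).
Qed.

(** Take the component of a vertex that does not reach everything, or its complement if the
    component has more than half of the vertices. *)
Lemma disconnected_cut F : ~~ sub_connected F ->
  exists S, [/\ S != set0, (2 * #|S| <= 3 ^ n)%N & no_crossing_edge F S].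
Proof.
move=> /sub_connectedP H.
have [x [y xy]] : exists x y, ~~ connect (sub_adj F) x y.
  case: (boolP [exists x, exists y, ~~ connect (sub_adj F) x y]).
    by case/existsP => x /existsP[y]; exists x, y.
  move=> /existsPn nH; case: H => x y; have /existsPn/(_ y) := nH x.
  by rewrite negbK.
have noC : no_crossing_edge F (component F x).
  apply/forall_inP => u; rewrite inE => xu; apply/forall_inP => w;
    rewrite !inE => xw.
  by apply: contra xw => uw; apply: connect_trans xu (connect1 uw).
have := cardsC (component F x); rewrite card_vertex => cC.
case: (leqP (2 * #|component F x|) (3 ^ n)) => le.
  exists (component F x); split=> //; apply/set0Pn; exists x.
  by rewrite inE connect0.
exists (~: component F x); split; last exact: no_crossingC; last by lia.
by apply/set0Pn; exists y; rewrite !inE.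
Qed.

(** * Closed sets encoded by the roots of their components *)

Section Roots.
Variable F : {set {set vertex n}}.
Let symF : connect_sym (sub_adj F) := sym_connect_sym (sub_adj_sym F).

Definition roots_in S := [set r in S | roots (sub_adj F) r].

Lemma mem_roots_in S x : no_crossing_edge F S ->
  (fingraph.root (sub_adj F) x \in roots_in S) = (x \in S).
Proof.
move=> noS; rewrite inE roots_root // andbT.
by rewrite (no_crossing_closed noS (connect_root _ x)).
Qed.

(** The fibre of the root map over a root in S is a whole component, because S is a union of
    components. *)
Lemma card_roots_in (m : nat) S : no_crossing_edge F S ->
  (forall x, m <= #|component F x|)%N -> (m * #|roots_in S| <= #|S|)%N.
Proof.
move=> noS Fm; have -> : #|S| = (\sum_(x in S) 1)%N by rewrite sum1_card.
rewrite (partition_big (fingraph.root (sub_adj F)) (mem (roots_in S))) /=;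
  last first.
  by move=> x xS; rewrite mem_roots_in.
rewrite mulnC -sum_nat_const; apply: leq_sum => r;
  rewrite inE => /andP[rS /eqP rr].
apply: leq_trans (Fm r) _; rewrite sum1dep_card; apply: subset_leq_card.
apply/subsetP => x; rewrite !inE => rx.
rewrite -(no_crossing_closed noS rx) rS /= -rr; apply/eqP/esym.
exact/(fingraph.rootP symF).
Qed.

(** S is recovered from its nonempty root set J. It has at least 6 m #|J| vertices, so its cut has
    at least m #|J| edges; summing q^(m #|J|) over all nonempty vertex sets J gives the binomial
    bound. *)
Lemma sum_closed_sets (R : numFieldType) (q : R) (m : nat) : 0 <= q <= 1 ->
  (forall x, 6 * m <= #|component F x|)%N ->
  \sum_(S : {set vertex n} |
        [&& S != set0, (2 * #|S| <= 3 ^ n)%N & no_crossing_edge F S])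
     q ^+ #|cut S| <= (1 + q ^+ m) ^+ (3 ^ n) - 1.
Proof.
move=> /andP[q0 q1] Fm; set A := BIG_P.
have -> : \sum_(S | A S) q ^+ #|cut S| =
    \sum_(S in [set S | A S]) q ^+ #|cut S|.
  by apply: eq_bigl => S; rewrite inE.
rewrite -card_vertex -sum_expr_card [X in _ <= X - 1](bigD1 set0) //=
  cards0 expr0 [1 + _]addrC addrK.
have roots_inj : {in [set S | A S] &, injective roots_in}.
  move=> S S'; rewrite !inE => /and3P[_ _ clS] /and3P[_ _ clS'] E.
  by apply/setP => x; rewrite -(mem_roots_in _ clS) E mem_roots_in.
apply: le_trans
  (_ : \sum_(J in roots_in @: [set S | A S]) (q ^+ m) ^+ #|J| <= _).
  rewrite big_imset //=; apply: ler_sum => S; rewrite inE => /and3P[_ hS clS].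
  rewrite -exprM; apply: ler_wiXn2l => //.
  rewrite -(@leq_pmul2l 6) // mulnA.
  exact: leq_trans (card_roots_in clS Fm) (card_le_cut hS).
rewrite [leRHS](bigID (mem (roots_in @: [set S | A S]))) /=.
rewrite (eq_bigl (fun J => (J != set0) && (J \in roots_in @: [set S | A S]))).
  by rewrite lerDl sumr_ge0 // => J _; rewrite !exprn_ge0.
move=> J /=; rewrite andb_idl // => /imsetP[S];
  rewrite inE => /and3P[/set0Pn[x xS] _ clS] ->.
by apply/set0Pn; exists (fingraph.root (sub_adj F) x); rewrite mem_roots_in.
Qed.

End Roots.

End Grid.

(** * The probability that some vertex has few open directions *)

Lemma sum_step_degree (R : comNzRingType) (q t : R) :
  \sum_(a : 'I_3) (q ^+ #|[set b | step a b]| + t) = t *+ 3 + q *+ 2 + q ^+ 2.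
Proof.
have deg (a : 'I_3) : #|[set b | step a b]| =
    (\sum_(b < 3) (`|a%:Z - b%:Z| == 1 :> int))%N.
  by rewrite -sum1dep_card big_mkcond.
(* The ends 0 and 2 of the path have one neighbour each, the middle value 1 has two. *)
rewrite !big_ord_recl big_ord0 !deg !big_ord_recl !big_ord0 /= !expr1 addr0.
by rewrite mulr2n mulrSr mulr2n; ring.
Qed.

(* Union bound over a vertex x and the set I of its closed directions, in which
   the condition #|~: I| < d is replaced by the weight t ^ (#|~: I| - d). *)
Lemma few_open_dirs_prob (R : realFieldType) (n d : nat) (p t : R) :
  0 <= p <= 1 -> 0 < t <= 1 ->
  \sum_(F : {set {set vertex n}} | (F \subset edges n) &&
        ~~ [forall x, d <= #|open_dirs F x|]%N) bernoulli_mass (edges n) p F <=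
  t ^- d * (t *+ 3 + (1 - p) *+ 2 + (1 - p) ^+ 2) ^+ n.
Proof.
move=> p01 /andP[t0 t1]; set E := edges n; set q := 1 - p.
have mass0 F : 0 <= bernoulli_mass E p F by apply: bernoulli_mass_ge0.
pose w (I : {set 'I_n}) := t ^- d * t ^+ #|~: I|.
have w0 I : 0 <= w I by rewrite /w mulr_ge0 ?invr_ge0 ?exprn_ge0 // ltW.
apply: le_trans (_ : \sum_(F : {set {set vertex n}} | F \subset E) \sum_x
   \sum_(I | [disjoint F & star x I]) w I * bernoulli_mass E p F <= _).
  rewrite big_mkcondr /=; apply: ler_sum => F _; case: ifPn => [|_]; last first.
    by apply: sumr_ge0 => x _; apply: sumr_ge0 => I _; rewrite mulr_ge0.
  (* Only the term of x with I the complement of its open directions is kept: fewer than d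
     directions are open and t <= 1, so its weight is at least 1. *)
  move=> /forallPn[x]; rewrite -ltnNge => dx.
  rewrite (bigD1 x) //= (bigD1 (~: open_dirs F x)) ?disjoint_star //= -addrA.
  rewrite -[leLHS]addr0; apply: lerD.
    rewrite -[leLHS]mul1r ler_wpM2r // /w setCK mulrC ler_pdivlMr ?exprn_gt0 //.
    by rewrite mul1r; apply: ler_wiXn2l; [exact: ltW | | exact: ltnW].
  apply: addr_ge0; first by apply: sumr_ge0 => I _; rewrite mulr_ge0.
  by apply: sumr_ge0 => y _; apply: sumr_ge0 => I _; rewrite mulr_ge0.
rewrite exchange_big /=.
under eq_bigr => x _.
  rewrite (exchange_big_dep predT) //=.
  under eq_bigr => I _.
    rewrite -mulr_sumr (bernoulli_avoid _ (star_sub_edges x I)) card_star.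
    over.
  over.
(* The sum over x and I factors over the coordinates: one in I contributes q to the degree of its
   value, any other contributes t. *)
have powE (s : R) : s ^+ n = \prod_(i < n) s by rewrite prodr_const card_ord.
rewrite -sum_step_degree [in leRHS]powE bigA_distr_bigA /= mulr_sumr.
apply: ler_sum => x _; rewrite bigA_distr mulr_sumr.
rewrite le_eqVlt; apply/predU1P; left; apply: eq_bigr => I _.
rewrite /w -mulrA; congr (_ * _); rewrite [RHS](bigID (mem I)) /= mulrC.
congr (_ * _).
  by rewrite -prodrXr; apply: eq_bigr => i iI; rewrite ifT.
rewrite -prodr_const; apply: eq_big => i; rewrite inE // => /negbTE iI.
by rewrite iI.
Qed.

(** * Sprinkling and the union bound over closed sets *)

Section UnionBound.
Variables (R : realType) (n d m : nat) (p p1 : R).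
Hypotheses (p1_ge0 : 0 <= p1) (p1_lt1 : p1 < 1) (p1p : p1 <= p).
Hypothesis p_le1 : p <= 1.
Hypothesis dm : (12 * m <= d * d.-1)%N.
Local Notation q := ((1 - p) / (1 - p1)).

Lemma disconnected_prob (t : R) : 0 < t <= 1 ->
  percolation_prob p (fun F : {set {set vertex n}} => ~~ sub_connected F) <=
  t ^- d * (t *+ 3 + (1 - p1) *+ 2 + (1 - p1) ^+ 2) ^+ n +
  ((1 + q ^+ m) ^+ (3 ^ n) - 1).
Proof.
move=> t01; set E := edges n.
have p1_neq1 : p1 != 1 by rewrite lt_eqF.
have p1_01 : 0 <= p1 <= 1 by rewrite p1_ge0 ltW.
have cpl0 G F : 0 <= coupling_mass E p1 p G F by apply: coupling_mass_ge0.
have q01 : 0 <= q <= 1.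
  rewrite divr_ge0 ?subr_ge0 ?(ltW p1_lt1) //= ler_pdivrMr ?subr_gt0 //.
  by rewrite mul1r lerD2l lerN2.
rewrite /percolation_prob.
under eq_bigr => F _.
  rewrite -[percolation_mass _ _]/(bernoulli_mass E p F) -(coupling_marginal _ p1).
  over.
rewrite exchange_big /=.
rewrite (bigID (fun G : {set {set vertex n}} =>
  ~~ [forall x, d <= #|open_dirs G x|]%N)) /=.
apply: lerD.
  apply: le_trans (few_open_dirs_prob n d p1_01 t01); apply: ler_sum => G _.
  rewrite -(coupling_total E p G p1_neq1)
    [leRHS](bigID (fun F => ~~ sub_connected F)) /=.
  by rewrite lerDl sumr_ge0.
(* For G with at least d open directions everywhere the conditional bound is uniform in G, so it
   suffices that such G have total mass at most 1. *)
apply: le_trans (_ : \sum_(G : {set {set vertex n}} | (G \subset E) &&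
    ~~ ~~ [forall x, d <= #|open_dirs G x|]%N) bernoulli_mass E p1 G *
    ((1 + q ^+ m) ^+ (3 ^ n) - 1) <= _); last first.
  rewrite -mulr_suml ler_piMl //.
    rewrite subr_ge0 exprn_ege1 // lerDl exprn_ge0 //; by case/andP: q01.
  rewrite -[leRHS](bernoulli_total E p1)
    [leRHS](bigID (fun G : {set {set vertex n}} =>
      ~~ [forall x, d <= #|open_dirs G x|]%N)) /=.
  by rewrite lerDr sumr_ge0 // => G _; apply: bernoulli_mass_ge0.
apply: ler_sum => G /andP[sGE]; rewrite negbK => /forallP Gd.
have Gm x : (6 * m <= #|component G x|)%N.
  rewrite -(@leq_pmul2l 2) // mulnA.
  exact: leq_trans dm (card_component x Gd).
apply: le_trans (_ : \sum_(F : {set {set vertex n}} | F \subset E)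
   \sum_(S : {set vertex n} | [&& S != set0,
     (2 * #|S| <= 3 ^ n)%N & [disjoint F & cut S]])
      coupling_mass E p1 p G F <= _).
  rewrite big_mkcondr /=; apply: ler_sum => F sFE; case: ifPn => [disF|_];
    last first.
    by apply: sumr_ge0.
  have [S [S0 hS noS]] := disconnected_cut disF.
  by rewrite (bigD1 S) /= ?lerDl ?sumr_ge0 // S0 hS -no_crossing_cut.
rewrite (exchange_big_dep (fun S : {set vertex n} =>
  (S != set0) && (2 * #|S| <= 3 ^ n)%N)) /=; last first.
  by move=> F S _ /and3P[-> ->].
apply: le_trans (ler_wpM2l (bernoulli_mass_ge0 _ _ p1_01)
  (sum_closed_sets q01 Gm)).
rewrite mulr_sumr [leRHS](eq_bigl (fun S : {set vertex n} =>
    ((S != set0) && (2 * #|S| <= 3 ^ n)%N) && [disjoint G & cut S]));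
      last first.
  by move=> S; rewrite -no_crossing_cut // andbA.
rewrite [leRHS]big_mkcondr /=; apply: ler_sum => S /andP[S0 hS].
(* Only sets S already closed in G contribute, each with the factor [q ^+ #|cut S|]. *)
rewrite -coupling_avoid ?cut_sub_edges // S0 hS.
exact: ler_sum.
Qed.

End UnionBound.

(** * Numerical estimates *)

Lemma expr1D_le (R : realFieldType) (y : R) (N : nat) :
  0 <= y -> y *+ N <= 1 / 2%:R -> (1 + y) ^+ N <= 1 + y *+ N *+ 2.
Proof.
move=> y0; elim: N => [|N IH]; first by rewrite !mul0rn expr0 addr0.
rewrite exprSr => yN; have yN0 : 0 <= y *+ N by apply: mulrn_wge0.
have {}IH : (1 + y) ^+ N <= 1 + y *+ N *+ 2.
  by apply: IH; move: yN; rewrite mulrS; lra.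
move: yN IH; rewrite mulrS; set s := y *+ N in yN0 * => yN IH.
apply: le_trans (ler_wpM2r _ IH) _; first lra.
(* Since s <= 1/2, the cross term 2 s y is at most y. *)
by rewrite !mulr2n; nra.
Qed.

(** Repeated squaring with rounding up keeps each numerical check down to the square of a short
    decimal. *)
Lemma expr_double_le (R : realFieldType) (x c c' : R) (k : nat) :
  0 <= x -> x ^+ k <= c -> c ^+ 2 <= c' -> x ^+ (k * 2) <= c'.
Proof.
move=> x0 xc; apply: le_trans; rewrite exprM lerXn2r // nnegrE ?exprn_ge0 //.
by apply: le_trans xc; rewrite exprn_ge0.
Qed.

Lemma disconnected_prob_le (R : realType) (p : R) (n : nat) :
  0 <= p <= 1 -> 67%:R / 100%:R <= p -> (200 * 100 <= n %/ 40)%N ->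
  percolation_prob p (fun F : {set {set vertex n}} => ~~ sub_connected F) <=
  (3%:R / 5%:R) ^+ (n %/ 40) + (1 / 2%:R) ^+ n *+ 2.
Proof.
move=> /andP[p0 p1] p_ge dn.
(* With these values the base 3t + 2(1 - p1') + (1 - p1')^2 is 0.8975 <= 9/10. As (9/10)^40 <=
   15/1000, each unit of d costs at most 40 · 15/1000 = 3/5. *)
pose p1' : R := 13%:R / 20%:R; pose t : R := 1 / 40%:R.
set d := (n %/ 40)%N in dn *; pose m := ((d * d.-1) %/ 12)%N.
have dm : (12 * m <= d * d.-1)%N by rewrite mulnC leq_trunc_div.
(* Here m is quadratic in d while n < 40 (d + 1); the factor 32 is an exponent with q^32 <= 1/6. *)
have mn : (32 * n <= m)%N.
  rewrite /m leq_divRL //; have := divn_eq n 40;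
    have := ltn_pmod n (isT : 0 < 40)%N.
  have : (d * (199 * 100) <= d * d.-1)%N by rewrite leq_mul2l; lia.
  by rewrite -/d; lia.
have Hp1 : p1' <= p by apply: le_trans p_ge; rewrite /p1'; lra.
have [p1'0 p1'1] : 0 <= p1' /\ p1' < 1 by rewrite /p1'; lra.
have t01 : 0 < t <= 1 by rewrite /t; lra.
apply: le_trans (disconnected_prob n p1'0 p1'1 Hp1 p1 dm t01) _.
apply: lerD.
  have c40 : (9%:R / 10%:R) ^+ (5 * 2 * 2 * 2) <= 15%:R / 1000%:R :> R.
    apply: (@expr_double_le _ _ (1217%:R / 10000%:R)); [lra| |lra].
    apply: (@expr_double_le _ _ (3488%:R / 10000%:R)); [lra| |lra].
    by apply: (@expr_double_le _ _ (5905%:R / 10000%:R)); lra.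
  rewrite -exprVn /t invf_div divr1.
  set b := _ + _; have [b0 b_le] : 0 <= b /\ b <= 9%:R / 10%:R.
    by rewrite /b /p1'; lra.
  move: b b0 b_le => b b0 b_le.
  apply: le_trans (_ : 40%:R ^+ d * ((9%:R / 10%:R) ^+ (5 * 2 * 2 * 2)) ^+ d <=
    _).
    rewrite ler_wpM2l ?exprn_ge0 // -exprM.
    apply: le_trans (_ : (9%:R / 10%:R) ^+ n <= _).
      by apply: lerXn2r; rewrite ?nnegrE //; lra.
    by apply: ler_wiXn2l; [lra|lra|rewrite mulnC leq_trunc_div].
  rewrite -exprMn lerXn2r // ?nnegrE; last lra; last lra.
  by rewrite mulr_ge0 // exprn_ge0 //; lra.
set q := (1 - p) / (1 - p1').
have q0 : 0 <= q by rewrite /q divr_ge0 // subr_ge0 // ltW.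
have q_le : q <= 33%:R / 35%:R.
  rewrite /q ler_pdivrMr ?subr_gt0 // /p1'; lra.
have q32 : q ^+ (1 * 2 * 2 * 2 * 2 * 2) <= 1 / 6%:R.
  apply: (@expr_double_le _ _ (3906%:R / 10000%:R)); [by []| |lra].
  apply: (@expr_double_le _ _ (6249%:R / 10000%:R)); [by []| |lra].
  apply: (@expr_double_le _ _ (7905%:R / 10000%:R)); [by []| |lra].
  apply: (@expr_double_le _ _ (889%:R / 1000%:R)); [by []| |lra].
  by apply: (@expr_double_le _ _ (33%:R / 35%:R)); lra.
have qm : q ^+ m <= (1 / 6%:R) ^+ n.
  apply: le_trans (_ : q ^+ (32 * n) <= _).
    by apply: ler_wiXn2l => //; lra.
  by rewrite exprM lerXn2r // nnegrE ?exprn_ge0 //; lra.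
(* The cost 6^-n beats the 3^n possible roots and leaves 2^-n. *)
have qN : q ^+ m *+ (3 ^ n) <= (1 / 2%:R) ^+ n.
  rewrite -[_ *+ _]mulr_natr natrX; apply: le_trans (ler_wpM2r _ qm) _.
    by rewrite exprn_ge0.
  by rewrite -exprMn lerXn2r // ?nnegrE; lra.
have n1 : (0 < n)%N by case: (n) @d dn {m dm mn qm qN}.
rewrite lerBlDl; apply: le_trans (expr1D_le _ _) _; first exact: exprn_ge0.
  apply: le_trans qN _; case: n n1 {mn dm dn m d qm} => // n _.
  by rewrite exprS ler_piMr ?exprn_ile1 //; lra.
by rewrite lerD2l lerMn2r.
Qed.

(* Limits as n tends to infinity *)
From mathcomp Require Import all_classical all_reals all_analysis.

Lemma sub_connected_prob (R : realType) (p : R) (n : nat) :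
  percolation_prob p (@sub_connected n) =
  1 - percolation_prob p (fun F : {set {set vertex n}} => ~~ sub_connected F).
Proof.
apply/eqP; rewrite -[X in _ == X - _](bernoulli_total (edges n) p); apply/eqP.
by rewrite [in RHS](bigID (@sub_connected n)) /= addrK.
Qed.

Lemma percolation_prob_ge0 (R : realType) (p : R) (n : nat) A :
  0 <= p <= 1 -> 0 <= @percolation_prob n R p A.
Proof. by move=> p01; apply: sumr_ge0 => F _; apply: bernoulli_mass_ge0. Qed.

Lemma isolated_prob_le (R : realType) (p : R) (n : nat) : 0 <= p <= 1 ->
  percolation_prob p (@has_isolated_connected_set n) <=
  percolation_prob p (fun F : {set {set vertex n}} => ~~ sub_connected F).
Proof.
move=> p01; rewrite /percolation_prob big_mkcondr [leRHS]big_mkcondr /=.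
apply: ler_sum => F _; case: ifPn => [/isolated_disconnected->//|_].
by case: ifP => // _; apply: bernoulli_mass_ge0.
Qed.

Import numFieldNormedType.Exports.
Local Open Scope classical_set_scope.
Local Open Scope ring_scope.

Lemma cvg_divn_infty (k : nat) : (0 < k)%N -> (fun n => n %/ k)%N @ \oo --> \oo.
Proof.
move=> k0 A [N _ NA]; exists (N * k)%N => // n /= Nn.
by apply: NA => /=; rewrite leq_divRL.
Qed.

Lemma disconnected_prob_cvg0 (R : realType) (p : R) :
  0 <= p <= 1 -> 67%:R / 100%:R <= p ->
  (fun n => percolation_prob p (fun F : {set {set vertex n}} =>
    ~~ sub_connected F))
    @ \oo --> (0 : R).
Proof.
move=> p01 p_ge.
apply: (@squeeze_cvgr _ _ _ _ (fun=> 0)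
  (fun n => (3%:R / 5%:R) ^+ (n %/ 40) + (1 / 2%:R) ^+ n *+ 2)).
- exists (200 * 100 * 40)%N => // n /= nbig; rewrite percolation_prob_ge0 //=.
  by apply: disconnected_prob_le; rewrite // leq_divRL.
- exact: cvg_cst.
- rewrite -[X in _ --> X]addr0 -[X in _ --> _ + X](mul0rn R 2); apply: cvgD.
    apply: (@cvg_comp _ _ _ (fun n => n %/ 40)%N (fun k =>
      (3%:R / 5%:R : R) ^+ k)).
      exact: cvg_divn_infty.
    by apply: cvg_expr; rewrite ger0_norm; lra.
  apply: cvgMn; apply: cvg_expr; rewrite ger0_norm; lra.
Qed.

Theorem theorem15 (R : realType) (p : R) (p01 : 0 <= p <= 1)
    (p_ge : 67%:R / 100%:R <= p) :
  ((fun n : nat => percolation_prob p (@has_isolated_connected_set n))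
     @ \oo --> (0 : R)) /\
  ((fun n : nat => percolation_prob p (@sub_connected n))
     @ \oo --> (1 : R)).
Proof.
(* The probability of disconnection dominates the first probability and is complementary to the
   second. *)
have disc0 := disconnected_prob_cvg0 p01 p_ge; split.
  apply: (squeeze_cvgr _ (cvg_cst 0) disc0); apply: nearW => n.
  by rewrite percolation_prob_ge0 // isolated_prob_le.
have -> : (fun n => percolation_prob p (@sub_connected n)) =
    (fun n => 1 - percolation_prob p (fun F : {set {set vertex n}} =>
      ~~ sub_connected F)).
  by apply/funext => n; apply: sub_connected_prob.
by have := cvgB (cvg_cst (1 : R)) disc0; rewrite subr0; apply.
Qed.
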